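(* Let $X$ be a Dedekind scheme. Then the class $\mathrm{Flat}(X)$ of flat quasi-coherent sheaves on $X$ is closed under taking products in $\mathfrak{Qcoh}(X)$.
   Context: $\mathfrak{Qcoh}(X)$ is the category of quasi-coherent sheaves on $X$ (a Grothendieck category, so it has direct products; these are in general not the products of $\mathcal{O}_X$-modules). A quasi-coherent sheaf $\mathcal{F}$ is flat if $\mathcal{F}(U)$ is a flat $\mathcal{O}_X(U)$-module for each affine open $U\subseteq X$ (equivalently, all stalks $\mathcal{F}_x$ are flat $\mathcal{O}_{X,x}$-modules). A Dedekind scheme is an integral noetherian scheme all of whose local rings are regular of dimension at most one. *)

(* Defs.v *)
From HB Require Import structures.
From mathcomp Require Import all_boot all_order all_algebra.
From mathcomp Require Import generic_quotient.
From mathcomp Require Import boolp classical_sets functions topology.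

Set Implicit Arguments.
Unset Strict Implicit.
Unset Printing Implicit Defensive.
Import GRing.Theory.
Local Open Scope classical_set_scope.
Local Open Scope quotient_scope.
Local Open Scope ring_scope.

(* Rings are [comPzRingType]: the zero ring must be allowed, being the ring of
   sections over the empty set.  For the same reason the ideals of
   [ring_quotient], which live over nonzero rings, are not usable here. *)

Section CommutativeAlgebra.
Variable A : comPzRingType.

Definition integral_domain : Prop :=
  (1 : A) <> 0 /\ (forall a b : A, a * b = 0 -> a = 0 \/ b = 0).

Definition ideal (I : set A) : Prop :=
  [/\ I 0, (forall a b, I a -> I b -> I (a + b))
    & (forall c a, I a -> I (c * a))].

Definition prime_ideal (p : set A) : Prop :=
  [/\ ideal p, ~ p 1 & (forall a b, p (a * b) -> p a \/ p b)].

Definition maximal_ideal (m : set A) : Prop :=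
  [/\ ideal m, ~ m 1
    & (forall J : set A, ideal J -> m `<=` J -> J = m \/ J = setT)].

Definition ideal_gen (s : seq A) : set A :=
  [set a | exists c : nat -> A, a = \sum_(i < size s) c i * s`_i].

Definition noetherian_ring : Prop :=
  forall I : set A, ideal I -> exists s : seq A, I = ideal_gen s.

Definition has_prime_chain (n : nat) : Prop :=
  exists p : nat -> set A,
    (forall i, (i <= n)%N -> prime_ideal (p i)) /\
    (forall i, (i < n)%N -> p i `<` p i.+1).

Definition krull_dim (d : nat) : Prop :=
  has_prime_chain d /\ ~ has_prime_chain d.+1.

Definition regular_local_ring (d : nat) : Prop :=
  noetherian_ring /\
  exists m : set A,
    [/\ maximal_ideal m, (forall m', maximal_ideal m' -> m' = m), krull_dim d
      & (exists s : seq A, size s = d /\ m = ideal_gen s)].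

End CommutativeAlgebra.

Record Spec (A : comPzRingType) : Type := MkSpec {
  spec_set :> set A;
  spec_prime : prime_ideal spec_set }.

Definition spec_mem (A : comPzRingType) (p : Spec A) (a : A) : Prop :=
  spec_set p a.
Coercion spec_mem : Spec >-> Funclass.

HB.instance Definition _ A := gen_eqMixin (Spec A).
HB.instance Definition _ A := gen_choiceMixin (Spec A).

Section Zariski.
Variable A : comPzRingType.

Definition zariski_open : set_system (Spec A) :=
  [set W | exists E : set A, W = [set p : Spec A | ~ E `<=` p]].

Lemma zariski_openT : zariski_open setT.
Proof.
exists setT; apply/seteqP; split=> p //= _ sub.
by have [_ + _] := spec_prime p; apply; apply: sub.
Qed.

Lemma zariski_openI : setI_closed zariski_open.
Proof.
move=> _ _ [E ->] [F ->].
exists [set c | exists2 a, E a & exists2 b, F b & c = a * b].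
apply/seteqP; split=> p /=.
- move=> [nE nF] sub; apply: nE => a Ea; apply: contrapT => npa.
  apply: nF => b Fb; have [_ _ pP] := spec_prime p.
  by case: (pP a b) => //; apply: sub; exists a => //; exists b.
- have [[_ _ pM] _ _] := spec_prime p.
  move=> nEF; split=> sub; apply: nEF => _ [a Ea [b Fb ->]].
  + by rewrite mulrC; apply/pM/sub.
  + by apply/pM/sub.
Qed.

Lemma zariski_open_bigU (I : Type) (f : I -> set (Spec A)) :
  (forall i, zariski_open (f i)) -> zariski_open (\bigcup_i f i).
Proof.
move=> /choice[E fE]; exists (\bigcup_i E i).
apply/seteqP; split=> p /=.
- by move=> [i _]; rewrite fE => nE sub; apply: nE => a Ea; apply: sub; exists i.
- move=> nE; apply: contrapT => np; apply: nE => a [i _ Eia].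
  by apply: contrapT => npa; apply: np; exists i => //; rewrite fE => /(_ a Eia).
Qed.

HB.instance Definition _ := isOpenTopological.Build (Spec A)
  zariski_openT zariski_openI zariski_open_bigU.

Definition spec_basic (f : A) : set (Spec A) := [set p : Spec A | ~ p f].

End Zariski.

(* [j] exhibits [B] as the localization of [A] at [f]. *)
Definition is_localization (A B : comPzRingType) (f : A)
    (j : {rmorphism A -> B}) : Prop :=
  [/\ (exists v : B, j f * v = 1),
      (forall b : B, exists n (a : A), j f ^+ n * b = j a)
    & (forall a : A, j a = 0 -> exists n, f ^+ n * a = 0)].

(* [N] is a [B]-module, and [j], semilinear along the localization [r] of [A]
   at [f], exhibits [N] as the localization of [M] at [f]. *)
Definition is_mod_localization (A B : comPzRingType) (r : {rmorphism A -> B})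
    (M : lmodType A) (N : lmodType B) (f : A) (j : {additive M -> N}) : Prop :=
  (forall y : N, exists n (x : M), r f ^+ n *: y = j x) /\
  (forall x : M, j x = 0 -> exists n, f ^+ n *: x = 0).

Section Tensor.
Variables (R : comPzRingType) (M N : lmodType R).

(* A sequence of pairs stands for the sum of the tensors of its items. *)
Inductive tensor_rel : seq (M * N) -> seq (M * N) -> Prop :=
| TensorRefl s : tensor_rel s s
| TensorSym s t : tensor_rel s t -> tensor_rel t s
| TensorTrans s t u : tensor_rel s t -> tensor_rel t u -> tensor_rel s u
| TensorPerm s t : perm_eq s t -> tensor_rel s t
| TensorCat s s' t t' :
    tensor_rel s s' -> tensor_rel t t' -> tensor_rel (s ++ t) (s' ++ t')
| Tensor0l y : tensor_rel [:: (0, y)] [::]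
| TensorDl x x' y : tensor_rel [:: (x + x', y)] [:: (x, y); (x', y)]
| Tensor0r x : tensor_rel [:: (x, 0)] [::]
| TensorDr x y y' : tensor_rel [:: (x, y + y')] [:: (x, y); (x, y')]
| TensorZ (a : R) x y : tensor_rel [:: (a *: x, y)] [:: (x, a *: y)].

Definition tensor_eqb (s t : seq (M * N)) : bool := `[< tensor_rel s t >].

Lemma tensor_eqb_refl : reflexive tensor_eqb.
Proof. by move=> s; apply/asboolP; exact: TensorRefl. Qed.

Lemma tensor_eqb_sym : symmetric tensor_eqb.
Proof. by move=> s t; apply/asboolP/asboolP; exact: TensorSym. Qed.

Lemma tensor_eqb_trans : transitive tensor_eqb.
Proof.
by move=> t s u /asboolP st /asboolP tu; apply/asboolP; exact: TensorTrans tu.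
Qed.

Canonical tensor_equiv :=
  EquivRel tensor_eqb tensor_eqb_refl tensor_eqb_sym tensor_eqb_trans.

Definition tensor := {eq_quot tensor_equiv}.

HB.instance Definition _ := Choice.on tensor.
HB.instance Definition _ := EqQuotient.on tensor.

Lemma tensor_piE (s t : seq (M * N)) :
  \pi_tensor s = \pi_tensor t <-> tensor_rel s t.
Proof.
split=> [/eqmodP/asboolP //|st]; first by apply/eqmodP/asboolP.
Qed.

Lemma tensorW (K : tensor -> Prop) :
  (forall s : seq (M * N), K (\pi_tensor s)) -> forall t, K t.
Proof. by move=> h t; rewrite -[t]reprK; exact: h. Qed.

Lemma tensor_reprK (s : seq (M * N)) :
  tensor_rel (repr (\pi_tensor s)) s.
Proof. by apply/tensor_piE; rewrite reprK. Qed.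

Definition pure (x : M) (y : N) : tensor := \pi_tensor [:: (x, y)].

Definition tensor_scale_seq (a : R) (s : seq (M * N)) :=
  [seq (a *: z.1, z.2) | z <- s].

Lemma tensor_scale_rel a s t :
  tensor_rel s t -> tensor_rel (tensor_scale_seq a s) (tensor_scale_seq a t).
Proof.
elim=> {s t}.
- by move=> s; exact: TensorRefl.
- by move=> s t _; exact: TensorSym.
- by move=> s t u _ st _; exact: TensorTrans.
- by move=> s t st; apply: TensorPerm; exact: perm_map.
- by move=> s s' t t' _ ss' _ tt'; rewrite /tensor_scale_seq !map_cat; exact: TensorCat.
- by move=> y /=; rewrite scaler0; exact: Tensor0l.
- by move=> x x' y /=; rewrite scalerDr; exact: TensorDl.
- by move=> x /=; exact: Tensor0r.
- by move=> x y y' /=; exact: TensorDr.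
- move=> b x y /=; rewrite scalerA mulrC -scalerA; exact: TensorZ.
Qed.

Definition tensor_add (s t : tensor) : tensor := \pi_tensor (repr s ++ repr t).
Definition tensor_scale (a : R) (s : tensor) : tensor :=
  \pi_tensor (tensor_scale_seq a (repr s)).
Definition tensor_opp (s : tensor) : tensor := tensor_scale (-1) s.

Lemma tensor_addE s t :
  tensor_add (\pi_tensor s) (\pi_tensor t) = \pi_tensor (s ++ t).
Proof. by apply/tensor_piE/TensorCat; exact: tensor_reprK. Qed.

Lemma tensor_scaleE a s :
  tensor_scale a (\pi_tensor s) = \pi_tensor (tensor_scale_seq a s).
Proof. by apply/tensor_piE/tensor_scale_rel; exact: tensor_reprK. Qed.

Lemma tensor_addA : associative tensor_add.
Proof.
move=> s t u; elim/tensorW: s => s; elim/tensorW: t => t; elim/tensorW: u => u.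
by rewrite !tensor_addE catA.
Qed.

Lemma tensor_addC : commutative tensor_add.
Proof.
move=> s t; elim/tensorW: s => s; elim/tensorW: t => t; rewrite !tensor_addE.
by apply/tensor_piE/TensorPerm; rewrite perm_catC.
Qed.

Lemma tensor_add0 : left_id (\pi_tensor [::]) tensor_add.
Proof. by move=> s; elim/tensorW: s => s; rewrite tensor_addE. Qed.

Lemma tensor_scaleDl s (a b : R) :
  tensor_scale (a + b) s = tensor_add (tensor_scale a s) (tensor_scale b s).
Proof.
elim/tensorW: s => s; rewrite !tensor_scaleE tensor_addE; apply/tensor_piE.
elim: s => [|[x y] s IH] /=; first exact: TensorRefl.
rewrite scalerDl.
apply: TensorTrans (TensorCat (TensorDl (a *: x) (b *: x) y) IH) _.
by apply/TensorPerm/permP => K; rewrite /= !count_cat /= [X in (_ + X)%N]addnCA.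
Qed.

Lemma tensor_scale0 s : tensor_scale 0 s = \pi_tensor [::].
Proof.
elim/tensorW: s => s; rewrite tensor_scaleE; apply/tensor_piE.
elim: s => [|[x y] s IH] /=; first exact: TensorRefl.
by rewrite scale0r; exact: (TensorCat (Tensor0l y) IH).
Qed.

Lemma tensor_scale1 : left_id 1 tensor_scale.
Proof.
move=> s; elim/tensorW: s => s; rewrite tensor_scaleE; congr (\pi _).
by elim: s => [|[x y] s IH] //=; rewrite scale1r IH.
Qed.

Lemma tensor_addN : left_inverse (\pi_tensor [::]) tensor_opp tensor_add.
Proof.
move=> s; rewrite /tensor_opp -{2}[s]tensor_scale1 -tensor_scaleDl.
by rewrite addNr tensor_scale0.
Qed.

HB.instance Definition _ := GRing.isZmodule.Build tensor
  tensor_addA tensor_addC tensor_add0 tensor_addN.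

Lemma tensor_scaleA a b s :
  tensor_scale a (tensor_scale b s) = tensor_scale (a * b) s.
Proof.
elim/tensorW: s => s; rewrite !tensor_scaleE /tensor_scale_seq -map_comp.
by congr (\pi _); apply: eq_map => z /=; rewrite scalerA.
Qed.

Lemma tensor_scaleDr : right_distributive tensor_scale +%R.
Proof.
move=> a s t; elim/tensorW: s => s; elim/tensorW: t => t.
rewrite -[LHS]/(tensor_scale a (tensor_add _ _)).
rewrite -[RHS]/(tensor_add (tensor_scale a _) (tensor_scale a _)).
by rewrite !(tensor_addE, tensor_scaleE) /tensor_scale_seq map_cat.
Qed.

HB.instance Definition _ := GRing.Zmodule_isLmodule.Build R tensor
  tensor_scaleA tensor_scale1 tensor_scaleDr tensor_scaleDl.

End Tensor.

Lemma tensor_rel_map (R : comPzRingType) (N' N M : lmodType R)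
    (u : {linear N' -> N}) (s t : seq (N' * M)) :
  tensor_rel s t ->
  tensor_rel [seq (u z.1, z.2) | z <- s] [seq (u z.1, z.2) | z <- t].
Proof.
elim=> {s t}.
- by move=> s; exact: TensorRefl.
- by move=> s t _; exact: TensorSym.
- by move=> s t r _ st _; exact: TensorTrans.
- by move=> s t st; apply: TensorPerm; exact: perm_map.
- by move=> s s' t t' _ ss' _ tt'; rewrite !map_cat; exact: TensorCat.
- by move=> y /=; rewrite linear0; exact: Tensor0l.
- by move=> x x' y /=; rewrite linearD; exact: TensorDl.
- by move=> x /=; exact: Tensor0r.
- by move=> x y y' /=; exact: TensorDr.
- by move=> a x y /=; rewrite linearZ; exact: TensorZ.
Qed.

Definition tensor_map (R : comPzRingType) (N' N M : lmodType R)
    (u : {linear N' -> N}) (t : tensor N' M) : tensor N M :=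
  \pi_(tensor N M) [seq (u z.1, z.2) | z <- repr t].

Lemma tensor_map_pure (R : comPzRingType) (N' N M : lmodType R)
    (u : {linear N' -> N}) (x : N') (y : M) :
  tensor_map u (pure x y) = pure (u x) y.
Proof.
apply/tensor_piE; exact: (tensor_rel_map u (tensor_reprK [:: (x, y)])).
Qed.

Definition flat_module (R : comPzRingType) (M : lmodType R) : Prop :=
  forall (N' N : lmodType R) (u : {linear N' -> N}),
    injective u -> injective (@tensor_map R N' N M u).

Record opens (X : topologicalType) : Type := MkOpens {
  opens_set :> set X;
  opens_open : open opens_set }.

Definition opens_mem (X : topologicalType) (U : opens X) (x : X) : Prop :=
  opens_set U x.
Coercion opens_mem : opens >-> Funclass.

Definition opensI (X : topologicalType) (U V : opens X) : opens X :=
  MkOpens (openI (opens_open U) (opens_open V)).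

Lemma opensIl (X : topologicalType) (U V : opens X) : opensI U V `<=` U.
Proof. by move=> x []. Qed.

Lemma opensIr (X : topologicalType) (U V : opens X) : opensI U V `<=` V.
Proof. by move=> x []. Qed.

Arguments opensIl {X} U V.
Arguments opensIr {X} U V.

Record ringed_space : Type := MkRingedSpace {
  space :> topologicalType;
  sect : opens space -> comPzRingType;
  res : forall U V : opens space, V `<=` U -> {rmorphism sect U -> sect V};
  res_id : forall (U : opens space) (UU : U `<=` U) (s : sect U),
    res UU s = s;
  res_comp : forall (U V W : opens space)
    (VU : V `<=` U) (WV : W `<=` V) (WU : W `<=` U) (s : sect U),
    res WV (res VU s) = res WU s;
  sect_sep : forall (U : opens space) (I : Type) (V : I -> opens space)
    (VU : forall i, V i `<=` U), U `<=` \bigcup_i V i ->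
    forall s t : sect U,
    (forall i, res (VU i) s = res (VU i) t) -> s = t;
  sect_glue : forall (U : opens space) (I : Type) (V : I -> opens space)
    (VU : forall i, V i `<=` U), U `<=` \bigcup_i V i ->
    forall s : (forall i, sect (V i)),
    (forall i j, res (opensIl (V i) (V j)) (s i)
               = res (opensIr (V i) (V j)) (s j)) ->
    exists t : sect U, forall i, res (VU i) t = s i }.

Section Stalk.
Variables (X : ringed_space) (x : X).

Record germ_rep : Type := MkGerm {
  germ_nbhs : opens X;
  germ_mem : germ_nbhs x;
  germ_sect : sect germ_nbhs }.

HB.instance Definition _ := gen_eqMixin germ_rep.
HB.instance Definition _ := gen_choiceMixin germ_rep.

Definition germ_rel (g h : germ_rep) : Prop :=
  exists (W : opens X) (Wg : W `<=` germ_nbhs g) (Wh : W `<=` germ_nbhs h),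
    W x /\ res Wg (germ_sect g) = res Wh (germ_sect h).

Definition germ_eqb (g h : germ_rep) : bool := `[< germ_rel g h >].

Lemma germ_eqb_refl : reflexive germ_eqb.
Proof.
move=> g; apply/asboolP; exists (germ_nbhs g), (@subset_refl _ _), (@subset_refl _ _).
by split=> //; exact: germ_mem.
Qed.

Lemma germ_eqb_sym : symmetric germ_eqb.
Proof.
by move=> g h; apply/asboolP/asboolP=> -[W [Wg [Wh [Wx e]]]]; exists W, Wh, Wg.
Qed.

Lemma germ_eqb_trans : transitive germ_eqb.
Proof.
move=> h g k /asboolP[W [Wg [Wh [Wx e]]]] /asboolP[W' [W'h [W'k [W'x e']]]].
apply/asboolP; pose V := opensI W W'.
have VW : V `<=` W := opensIl _ _.
have VW' : V `<=` W' := opensIr _ _.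
exists V, (subset_trans VW Wg), (subset_trans VW' W'k); split; first by split.
rewrite -(res_comp Wg VW) e (res_comp _ _ (subset_trans VW Wh)).
by rewrite -(res_comp W'k VW') -e' (res_comp _ _ (subset_trans VW Wh)).
Qed.

Canonical germ_equiv :=
  EquivRel germ_eqb germ_eqb_refl germ_eqb_sym germ_eqb_trans.

Definition stalk := {eq_quot germ_equiv}.

HB.instance Definition _ := Choice.on stalk.
HB.instance Definition _ := EqQuotient.on stalk.

Definition germ (U : opens X) (Ux : U x) (s : sect U) : stalk :=
  \pi_stalk (MkGerm Ux s).

Lemma germP (U V : opens X) (Ux : U x) (Vx : V x) (s : sect U) (t : sect V) :
  germ Ux s = germ Vx t <->
  exists (W : opens X) (WU : W `<=` U) (WV : W `<=` V),
    W x /\ res WU s = res WV t.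
Proof.
by split=> [/eqmodP/asboolP //|h]; apply/eqmodP/asboolP.
Qed.

Lemma germ_res (U V : opens X) (Ux : U x) (Vx : V x) (VU : V `<=` U)
  (s : sect U) : germ Vx (res VU s) = germ Ux s.
Proof.
by apply/germP; exists V, (@subset_refl _ _), VU; split=> //; rewrite res_id.
Qed.

Lemma stalkW (K : stalk -> Prop) :
  (forall (U : opens X) (Ux : U x) (s : sect U), K (germ Ux s)) ->
  forall g, K g.
Proof. by move=> h; elim/quotW=> -[U Ux s]; exact: h. Qed.

Lemma germ_common2 (K : stalk -> stalk -> Prop) :
  (forall (U : opens X) (Ux : U x) (s t : sect U), K (germ Ux s) (germ Ux t)) ->
  forall g h, K g h.
Proof.
move=> Kp; apply: stalkW => U Ux s; apply: stalkW => V Vx t.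
pose W := opensI U V; have Wx : W x by split.
rewrite -(germ_res Ux Wx (opensIl _ _)) -(germ_res Vx Wx (opensIr _ _)).
exact: Kp.
Qed.

Lemma germ_common3 (K : stalk -> stalk -> stalk -> Prop) :
  (forall (U : opens X) (Ux : U x) (s t r : sect U),
     K (germ Ux s) (germ Ux t) (germ Ux r)) ->
  forall g h k, K g h k.
Proof.
move=> Kp g h; move: g h; apply: germ_common2 => U Ux s t.
apply: stalkW => V Vx r; pose W := opensI U V; have Wx : W x by split.
rewrite -!(germ_res Ux Wx (opensIl _ _)) -(germ_res Vx Wx (opensIr _ _)).
exact: Kp.
Qed.

Definition germ_op (op : forall U : opens X, sect U -> sect U -> sect U)
    (g h : stalk) : stalk :=
  let: MkGerm U Ux s := repr g in
  let: MkGerm V Vx t := repr h in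
  @germ (opensI U V) (conj Ux Vx)
    (op _ (res (opensIl _ _) s) (res (opensIr _ _) t)).

Lemma germ_opE (op : forall U : opens X, sect U -> sect U -> sect U)
  (opP : forall (U V : opens X) (VU : V `<=` U) (s t : sect U),
     res VU (op U s t) = op V (res VU s) (res VU t))
  (U : opens X) (Ux : U x) (s t : sect U) :
  germ_op op (germ Ux s) (germ Ux t) = germ Ux (op U s t).
Proof.
rewrite /germ_op.
have := reprK (germ Ux s); have := reprK (germ Ux t).
case: (repr _) => V Vx t'; case: (repr _) => V' V'x s'.
move=> /germP[W [WV [WU [Wx et]]]] /germP[W' [W'V' [W'U [W'x es]]]].
apply/germP; pose W2 := opensI W W'.
have aW : W2 `<=` W := opensIl _ _.
have aW' : W2 `<=` W' := opensIr _ _.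
have aV := subset_trans aW WV; have aV' := subset_trans aW' W'V'.
have aU := subset_trans aW WU.
exists W2, (fun y h => conj (aV' y h) (aV y h)), aU; split; first by split.
rewrite !opP (res_comp _ _ aV') (res_comp _ _ aV).
rewrite -(res_comp WV aW) et (res_comp _ _ aU).
by rewrite -(res_comp W'V' aW') es (res_comp _ _ aU).
Qed.

Definition germ_add := germ_op (fun U => +%R).
Definition germ_mul := germ_op (fun U => *%R).
Definition openT_opens : opens X := MkOpens openT.
Lemma opens_subT (U : opens X) : U `<=` openT_opens.
Proof. by []. Qed.
Definition germ_cst (c : sect openT_opens) : stalk := @germ openT_opens I c.
Definition germ_opp (g : stalk) : stalk := germ_mul (germ_cst (-1)) g.

Lemma germ_addE (U : opens X) (Ux : U x) (s t : sect U) :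
  germ_add (germ Ux s) (germ Ux t) = germ Ux (s + t).
Proof. by apply: germ_opE => *; rewrite rmorphD. Qed.

Lemma germ_mulE (U : opens X) (Ux : U x) (s t : sect U) :
  germ_mul (germ Ux s) (germ Ux t) = germ Ux (s * t).
Proof. by apply: germ_opE => *; rewrite rmorphM. Qed.

Lemma germ_cst0 (U : opens X) (Ux : U x) : germ_cst 0 = germ Ux 0.
Proof. by rewrite /germ_cst -(germ_res _ Ux (@opens_subT U)) rmorph0. Qed.

Lemma germ_cst1 (U : opens X) (Ux : U x) : germ_cst 1 = germ Ux 1.
Proof. by rewrite /germ_cst -(germ_res _ Ux (@opens_subT U)) rmorph1. Qed.

Lemma germ_oppE (U : opens X) (Ux : U x) (s : sect U) :
  germ_opp (germ Ux s) = germ Ux (- s).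
Proof.
rewrite /germ_opp /germ_cst -(germ_res _ Ux (@opens_subT U)).
by rewrite germ_mulE rmorphN1 mulN1r.
Qed.

Lemma germ_addA : associative germ_add.
Proof. by apply: germ_common3 => U Ux s t r; rewrite !germ_addE addrA. Qed.

Lemma germ_addC : commutative germ_add.
Proof. by apply: germ_common2 => U Ux s t; rewrite !germ_addE addrC. Qed.

Lemma germ_add0 : left_id (germ_cst 0) germ_add.
Proof.
by apply: stalkW => U Ux s; rewrite (germ_cst0 Ux) germ_addE add0r.
Qed.

Lemma germ_addN : left_inverse (germ_cst 0) germ_opp germ_add.
Proof.
by apply: stalkW => U Ux s; rewrite germ_oppE germ_addE addNr (germ_cst0 Ux).
Qed.

HB.instance Definition _ := GRing.isZmodule.Build stalk
  germ_addA germ_addC germ_add0 germ_addN.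

Lemma germ_mulA : associative germ_mul.
Proof. by apply: germ_common3 => U Ux s t r; rewrite !germ_mulE mulrA. Qed.

Lemma germ_mulC : commutative germ_mul.
Proof. by apply: germ_common2 => U Ux s t; rewrite !germ_mulE mulrC. Qed.

Lemma germ_mul1 : left_id (germ_cst 1) germ_mul.
Proof.
by apply: stalkW => U Ux s; rewrite (germ_cst1 Ux) germ_mulE mul1r.
Qed.

Lemma germ_mulD : left_distributive germ_mul +%R.
Proof.
rewrite -[+%R]/germ_add; apply: germ_common3 => U Ux s t r.
by rewrite !(germ_addE, germ_mulE) mulrDl.
Qed.

HB.instance Definition _ := GRing.Zmodule_isComPzRing.Build stalk
  germ_mulA germ_mulC germ_mul1 germ_mulD.

End Stalk.

(* [psi] underlies an isomorphism from the spectrum of [A := sect U] to the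
   open subspace [U].  The structure sheaf of the spectrum is the sheaf whose
   restriction to the basis of the [D(f)] is given by the localizations [A_f],
   so an isomorphism of sheaves of rings amounts to each restriction map
   [A -> sect (psi D(f))] being the localization of [A] at [f]. *)
Definition affine_chart (X : ringed_space) (U : opens X)
    (psi : Spec (sect U) -> X) : Prop :=
  [/\ set_bij setT U psi,
      (forall W : set (Spec (sect U)), open W <-> open (psi @` W))
    & (forall (f : sect U) (V : opens X) (VU : V `<=` U),
         psi @` spec_basic f = V :> set X -> is_localization f (res VU))].

Definition affine_open (X : ringed_space) (U : opens X) : Prop :=
  exists psi : Spec (sect U) -> X, affine_chart psi.

Record scheme : Type := MkScheme {
  ringed_space_of :> ringed_space;
  scheme_affine : forall x : ringed_space_of,
    exists U : opens ringed_space_of, affine_open U /\ U x }.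

Definition integral_scheme (X : scheme) : Prop :=
  [set: X] !=set0 /\
  forall U : opens X, U !=set0 -> integral_domain (sect U).

Definition noetherian_scheme (X : scheme) : Prop :=
  exists (n : nat) (U : 'I_n -> opens X),
    (forall i, affine_open (U i) /\ noetherian_ring (sect (U i))) /\
    [set: X] `<=` \bigcup_i U i.

Definition dedekind_scheme (X : scheme) : Prop :=
  [/\ integral_scheme X, noetherian_scheme X
    & (forall x : X, exists2 d, (d <= 1)%N & regular_local_ring (stalk x) d)].

Record sheaf_mod (X : ringed_space) : Type := MkSheafMod {
  msect :> forall U : opens X, lmodType (sect U);
  mres : forall U V : opens X, V `<=` U -> {additive msect U -> msect V};
  mresZ : forall (U V : opens X) (VU : V `<=` U) (a : sect U) (s : msect U),
    mres VU (a *: s) = res VU a *: mres VU s;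
  mres_id : forall (U : opens X) (UU : U `<=` U) (s : msect U),
    mres UU s = s;
  mres_comp : forall (U V W : opens X)
    (VU : V `<=` U) (WV : W `<=` V) (WU : W `<=` U) (s : msect U),
    mres WV (mres VU s) = mres WU s;
  msect_sep : forall (U : opens X) (I : Type) (V : I -> opens X)
    (VU : forall i, V i `<=` U), U `<=` \bigcup_i V i ->
    forall s t : msect U,
    (forall i, mres (VU i) s = mres (VU i) t) -> s = t;
  msect_glue : forall (U : opens X) (I : Type) (V : I -> opens X)
    (VU : forall i, V i `<=` U), U `<=` \bigcup_i V i ->
    forall s : (forall i, msect (V i)),
    (forall i j,
        mres (opensIl (V i) (V j)) (s i)
      = mres (opensIr (V i) (V j)) (s j)) ->
    exists t : msect U, forall i, mres (VU i) t = s i }.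

(* On each affine open [U], the sheaf is the one associated with the module
   [F U], i.e. the one whose sections over [D(f)] are the localization of
   [F U] at [f]. *)
Definition quasi_coherent (X : scheme) (F : sheaf_mod X) : Prop :=
  forall (U : opens X) (psi : Spec (sect U) -> X), affine_chart psi ->
  forall (f : sect U) (V : opens X) (VU : V `<=` U),
    psi @` spec_basic f = V :> set X ->
    is_mod_localization (res VU) f (mres F VU).

Record qcoh (X : scheme) : Type := MkQcoh {
  sheaf_of :> sheaf_mod X;
  qcoh_prop : quasi_coherent sheaf_of }.

Record qcoh_hom (X : scheme) (F G : qcoh X) : Type := MkQcohHom {
  hom_sect :> forall U : opens X, {linear F U -> G U};
  hom_res : forall (U V : opens X) (VU : V `<=` U) (s : F U),
    hom_sect V (mres F VU s) = mres G VU (hom_sect U s) }.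

(* [P] with the projections [pr] is a product of the family [F] in the
   category of quasi-coherent sheaves. *)
Definition is_qcoh_product (X : scheme) (I : Type) (F : I -> qcoh X)
    (P : qcoh X) (pr : forall i, qcoh_hom P (F i)) : Prop :=
  forall (G : qcoh X) (g : forall i, qcoh_hom G (F i)),
    (exists h : qcoh_hom G P,
       forall i (U : opens X) (s : G U), pr i U (h U s) = g i U s) /\
    (forall h h' : qcoh_hom G P,
       (forall i (U : opens X) (s : G U), pr i U (h U s) = g i U s) ->
       (forall i (U : opens X) (s : G U), pr i U (h' U s) = g i U s) ->
       forall (U : opens X) (s : G U), h U s = h' U s).

Definition flat_qcoh (X : scheme) (F : qcoh X) : Prop :=
  forall U : opens X, affine_open U -> flat_module (F U).

(* Main.v *)
Require Import Defs.
From HB Require Import structures.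
From mathcomp Require Import all_boot all_order all_algebra.
From mathcomp Require Import generic_quotient.
From mathcomp Require Import boolp classical_sets functions topology.

Set Implicit Arguments.
Unset Strict Implicit.
Unset Printing Implicit Defensive.
Import GRing.Theory.
Local Open Scope classical_set_scope.
Local Open Scope quotient_scope.
Local Open Scope ring_scope.

(** On a Dedekind scheme a quasi-coherent sheaf is flat exactly when its sections
over nonempty affine opens are torsion-free, so it is enough to show that the
categorical product [P] of flat sheaves [F i] has no torsion.  Products of
quasi-coherent sheaves are not computed section by section; the argument uses
only their universal property.  The torsion sections of [P] form a
quasi-coherent subsheaf [T].  Its image under each projection is torsion in the
flat sheaf [F i], hence zero.  So the inclusion of [T] into [P] and the zero
morphism have the same composites with all projections, whence they agree and
[T = 0].

On an integral scheme a section is torsion when it vanishes on some nonempty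
open subset ([torsion_section]).  In this form the sheaf axioms and
quasi-coherence ([torsion_sheaf_quasi_coherent]) follow from the fact that two
nonempty opens always meet ([integral_irreducible]).  A flat module over a
domain is torsion-free because it preserves the injectivity of the
multiplication by a nonzero scalar ([flat_torsion_free]); consequently a section
of a flat sheaf that vanishes on a nonempty open is zero ([flat_section_eq0]).

The step from torsion-free to flat ([torsion_free_flat]) is where the local
rings enter.  In a regular local ring of dimension at most one, of any two
elements one divides the other ([regular_local_comparable]); on an affine open
this means that at each prime [p] the divisibility holds after multiplication
by some [s] outside [p] ([stalk_comparable]).  Finitely many elements of a
torsion-free module then lie, again up to such an [s], in the span of a linearly
independent family ([torsion_free_local_basis]).  A relation among tensors
involves only finitely many elements of the module ([tensor_rel_eval]), so it
can be read in coordinates on that family, where injectivity on the other factor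
applies.  The scalars killing the difference of two tensors thus form an ideal
contained in no prime, that is, the unit ideal. *)

(** * Ideals *)

(** Zorn's lemma: a union of a nonempty chain of proper ideals is a proper
ideal, as it misses [1]. *)
Lemma proper_ideal_sub_maximal (A : comPzRingType) (I : set A) :
  ideal I -> ~ I 1 -> exists2 m, maximal_ideal m & I `<=` m.
Proof.
move=> idI I1.
(* The empty set is admitted only to bound the empty chain. *)
pose Pr := [set J : set A | J = set0 \/ [/\ ideal J, I `<=` J & ~ J 1]].
have [F FPr tF|J [[J0|[idJ IJ J1]] maxJ]] := @Zorn_bigcup _ Pr.
- have [[K FK [x Kx]]|noK] := pselect (exists2 K, F K & K !=set0); last first.
    left; apply/seteqP; split=> // x [K FK Kx]; apply: noK.
    by exists K => //; exists x.
  have FE L y : F L -> L y -> [/\ ideal L, I `<=` L & ~ L 1].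
    by move=> FL Ly; have [L0|] := FPr _ FL; first by rewrite L0 in Ly.
  have [[K0 KD KM] IK _] := FE _ _ FK Kx.
  right; split.
  + split; first by exists K.
    * move=> a b [L FL La] [L' FL' Lb].
      have [[_ LD _] _ _] := FE _ _ FL La; have [[_ LD' _] _ _] := FE _ _ FL' Lb.
      have [LL'|L'L] := tF _ _ FL FL'.
      - by exists L' => //; apply: LD' => //; apply: LL'.
      - by exists L => //; apply: LD => //; apply: L'L.
    * move=> c a [L FL La]; exists L => //.
      by have [[_ _ LM] _ _] := FE _ _ FL La; apply: LM.
  + by move=> y Iy; exists K => //; apply: IK.
  + by move=> [L FL L1]; have [_ _] := FE _ _ FL L1; apply.
- case: (maxJ I); last by right; split.
  rewrite J0; split=> // /(_ 0); case: idI => I0 _ _; exact.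
- exists J => //; split=> // K idK JK.
  have [K1|K1] := pselect (K 1).
    right; apply/seteqP; split=> // a _; rewrite -[a]mulr1.
    by case: idK => _ _; apply.
  left; apply: contrapT => KJ; apply: (maxJ K).
    by split=> // KJ'; apply: KJ; apply/seteqP.
  by right; split=> //; apply: subset_trans JK.
Qed.

Lemma ideal_add_principal (A : comPzRingType) (m : set A) (a : A) :
  ideal m -> ideal [set x | exists2 y, m y & exists c, x = y + c * a].
Proof.
case=> m0 mD mM; split.
- by exists 0 => //; exists 0; rewrite mul0r addr0.
- move=> _ _ [y my [c ->]] [y' my' [c' ->]]; exists (y + y'); first exact: mD.
  by exists (c + c'); rewrite mulrDl addrACA.
- move=> c _ [y my [d ->]]; exists (c * y); first exact: mM.
  by exists (c * d); rewrite mulrDr mulrA.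
Qed.

Lemma maximal_ideal_comaximal (A : comPzRingType) (m : set A) (a : A) :
  maximal_ideal m -> ~ m a -> exists2 y, m y & exists c, 1 = y + c * a.
Proof.
case=> idm _ maxm nma.
case: (maxm _ (ideal_add_principal a idm)) => [y my|e|e].
- by exists y => //; exists 0; rewrite mul0r addr0.
- case: nma; rewrite -e; exists 0; first by case: idm.
  by exists 1; rewrite mul1r add0r.
- by move/seteqP: e => [_ /(_ 1 Logic.I)].
Qed.

Lemma maximal_ideal_prime (A : comPzRingType) (m : set A) :
  maximal_ideal m -> prime_ideal m.
Proof.
move=> maxm; have [idm m1 _] := maxm; have [m0 mD mM] := idm; split=> // a b mab.
apply: contrapT => /not_orP[/(maximal_ideal_comaximal maxm)[y my [c ec]]].
move=> /(maximal_ideal_comaximal maxm)[z mz [d ed]]; apply: m1.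
have -> : 1 = (z + d * b) * y + (c * a) * z + (c * d) * (a * b).
  by rewrite -ed mul1r -addrA mulrACA -mulrDr -ed mulr1.
by apply: (mD); [apply: (mD)|]; apply: mM.
Qed.

Lemma principal_ideal (A : comPzRingType) (a : A) : ideal [set c * a | c in setT].
Proof.
split; first by exists 0; rewrite ?mul0r.
- by move=> _ _ [c _ <-] [d _ <-]; exists (c + d); rewrite ?mulrDl.
- by move=> c _ [d _ <-]; exists (c * d); rewrite ?mulrA.
Qed.

(** Otherwise the principal ideal of [a] is proper, and so lies in some maximal
ideal. *)
Lemma notin_maximal_unit (A : comPzRingType) (a : A) :
  (forall m, maximal_ideal m -> ~ m a) -> exists v, v * a = 1.
Proof.
move=> nma; have [[v _ e]|n1] := pselect ([set c * a | c in setT] 1).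
  by exists v.
have [m maxm sub] := proper_ideal_sub_maximal (principal_ideal a) n1.
by case: (nma m maxm); apply: sub; exists 1; rewrite ?mul1r.
Qed.

(** * Divisibility in regular local rings of dimension at most one *)

(** When [S] is the complement of a prime, this says that, of the images of [a]
and [b] in the localization, one divides the other. *)
Definition comparable_mod (A : comPzRingType) (S : set A) (a b : A) : Prop :=
  exists2 s, S s & (exists c, s * b = c * a) \/ (exists c, s * a = c * b).

(** If [a] had no such factorization, dividing by [t] could go on forever, with
[a = t * a1], [a1 = t * a2] and so on.  The increasing ideals generated by the
quotients become stationary in a noetherian ring, so that some quotient [b]
satisfies [b = c * t * b].  Since [1 - c * t] is a unit, [b = 0], a
contradiction. *)
Lemma local_principal_factor (A : comPzRingType) (m : set A) (t : A) :
  noetherian_ring A -> maximal_ideal m ->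
  (forall m', maximal_ideal m' -> m' = m) ->
  (forall a, m a -> exists c, a = t * c) -> m t ->
  forall a : A, a <> 0 -> exists n u v, v * u = 1 /\ a = t ^+ n * u.
Proof.
move=> noeth maxm uniqm mt tm.
pose good a := exists n u v, v * u = 1 /\ a = t ^+ n * u.
move=> a a0; apply: contrapT => bad_a.
have step b : exists c, (b <> 0 /\ ~ good b) -> b = t * c /\ (c <> 0 /\ ~ good c).
  have [[b0 bad]|] := pselect (b <> 0 /\ ~ good b); last by move=> nb; exists 0.
  have mb : m b.
    apply: contrapT => nmb; apply: bad; exists 0%N, b.
    have [m' /uniqm -> //|v vb] := @notin_maximal_unit _ b.
    by exists v; rewrite expr0 mul1r.
  have [c ec] := mt b mb; exists c => _; split=> //; split=> [c0|[n [u [v [vu e]]]]].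
    by apply: b0; rewrite ec c0 mulr0.
  by apply: bad; exists n.+1, u, v; split=> //; rewrite ec e mulrA -exprS.
have [f fP] := choice step.
pose g n := iter n f a.
have gP n : g n <> 0 /\ ~ good (g n).
  by elim: n => [//|n IH]; have [_] := fP _ IH.
have gS n : g n = t * g n.+1 by have [] := fP _ (gP n).
have gle i j : (i <= j)%N -> exists c, g i = c * g j.
  move=> /subnK <-; elim: (j - i)%N => [|k [c e]]; first by exists 1; rewrite mul1r.
  by exists (c * t); rewrite e addSn -mulrA -gS.
pose J := [set x | exists n c, x = c * g n].
have idJ : ideal J.
  split; first by exists 0%N, 0; rewrite mul0r.
  - move=> _ _ [i [c ->]] [j [d ->]]; exists (maxn i j).
    have [c' ->] := gle _ _ (leq_maxl i j); have [d' ->] := gle _ _ (leq_maxr i j).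
    by exists (c * c' + d * d'); rewrite mulrDl !mulrA.
  - by move=> c _ [i [d ->]]; exists i, (c * d); rewrite mulrA.
have [s Js] := noeth J idJ.
(* One term of the chain absorbs the finitely many generators of [J]. *)
have [N sN] : exists N, forall i, (i < size s)%N -> exists c, s`_i = c * g N.
  have sJ i : (i < size s)%N -> J s`_i.
    move=> si; rewrite Js; exists (fun j => (j == i)%:R).
    rewrite (bigD1 (Ordinal si)) //= eqxx mul1r big1 ?addr0 // => j.
    by rewrite -val_eqE /= => /negbTE ->; rewrite mul0r.
  elim: (s) sJ => [|x r IH] sJ; first by exists 0%N.
  have [N NP] := IH (fun i => sJ i.+1).
  have [k [c /= e]] := sJ 0%N isT; exists (maxn N k) => -[_|i /= /NP[d ->]].
    have [d ed] := gle _ _ (leq_maxr N k); rewrite /= e ed.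
    by exists (c * d); rewrite mulrA.
  by have [d' ->] := gle _ _ (leq_maxl N k); exists (d * d'); rewrite mulrA.
have [c ec] : exists c, g N.+1 = c * g N.
  have : J (g N.+1) by exists N.+1, 1; rewrite mul1r.
  rewrite Js => -[k ->].
  have [i|d dP] := @choice _ _ (fun i x => (i < size s)%N -> s`_i = x * g N).
    by have [/sN[x ->]|_] := boolP (i < size s)%N; [exists x|exists 0].
  exists (\sum_(i < size s) k i * d i); rewrite mulr_suml.
  by apply: eq_bigr => i _; rewrite dP // mulrA.
have [m' /uniqm -> m1|v v1] := @notin_maximal_unit _ (1 - c * t).
  have [[_ mD mM] m1' _] := maxm; apply: m1'.
  by rewrite -[1](subrK (c * t)); apply: mD => //; apply: mM.
have [+ _] := gP N.+1; apply; rewrite -[LHS]mul1r -v1 -mulrA.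
by rewrite mulrBl mul1r -mulrA -gS -ec subrr mulr0.
Qed.

(** The maximal ideal is generated by at most one element [t], so that nonzero
elements are powers of [t] up to units. *)
Lemma regular_local_comparable (A : comPzRingType) (d : nat) :
  (d <= 1)%N -> regular_local_ring A d ->
  forall a b : A, (exists c, b = c * a) \/ (exists c, a = c * b).
Proof.
move=> d1 [noeth [m [maxm uniqm _ [s [szs ms]]]]].
have [t [tm mt]] : exists t, m t /\ forall a, m a -> exists c, a = t * c.
  case: d s d1 szs ms => [|[|//]] [|t [|//]] // _ _ ms.
    exists 0; split; first by have [[]] := maxm.
    by move=> a; rewrite ms => -[c ->]; exists 0; rewrite big_ord0 mulr0.
  exists t; rewrite ms; split; first by exists (fun=> 1); rewrite big_ord1 mul1r.
  by move=> a [c ->]; exists (c 0%N); rewrite big_ord1 mulrC.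
have fac := local_principal_factor noeth maxm uniqm mt tm.
move=> a b; have [->|/eqP/fac[i [u [u' [uu ->]]]]] := eqVneq a 0.
  by right; exists 0; rewrite mul0r.
have [->|/eqP/fac[j [v [v' [vv ->]]]]] := eqVneq b 0.
  by left; exists 0; rewrite mul0r.
wlog ij : i j u v u' v' uu vv / (i <= j)%N => [hw|].
  have [ij|/ltnW ji] := leqP i j; first exact: hw uu vv ij.
  by have [H|H] := hw _ _ _ _ _ _ vv uu ji; [right|left].
left; exists (t ^+ (j - i) * v * u').
rewrite [t ^+ i * u]mulrC mulrA -[_ * u' * u]mulrA uu mulr1.
by rewrite -mulrA [v * _]mulrC mulrA -exprD subnK.
Qed.

(** * Torsion-free modules *)

Definition torsion_free (R : comPzRingType) (M : lmodType R) : Prop :=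
  forall (a : R) (x : M), a *: x = 0 -> a = 0 \/ x = 0.

Section Span.
Variables (R : comPzRingType) (M : lmodType R).

Definition span (E : seq M) : set M :=
  [set x | exists c : nat -> R, x = \sum_(i < size E) c i *: E`_i].

Definition independent (E : seq M) : Prop :=
  forall c : nat -> R, \sum_(i < size E) c i *: E`_i = 0 ->
  forall i, (i < size E)%N -> c i = 0.

Lemma span0 E : span E 0.
Proof. by exists (fun=> 0); rewrite big1 // => i _; rewrite scale0r. Qed.

Lemma spanP E a x y : span E x -> span E y -> span E (a *: x + y).
Proof.
move=> [c ->] [d ->]; exists (fun i => a * c i + d i).
rewrite scaler_sumr -big_split /=; apply: eq_bigr => i _.
by rewrite scalerDl scalerA.
Qed.

Lemma spanZ E a x : span E x -> span E (a *: x).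
Proof. by move=> Ex; rewrite -[_ *: _]addr0; apply: spanP => //; apply: span0. Qed.

Lemma spanD E x y : span E x -> span E y -> span E (x + y).
Proof. by move=> Ex; rewrite -[x]scale1r; apply: spanP. Qed.

Lemma span_mem E x : x \in E -> span E x.
Proof.
move=> xE; exists (fun i => (i == index x E)%:R).
have xi : (index x E < size E)%N by rewrite index_mem.
rewrite (bigD1 (Ordinal xi)) //= eqxx scale1r nth_index // big1 ?addr0 // => i.
by rewrite -val_eqE /= => /negbTE ->; rewrite scale0r.
Qed.

Lemma span_sub (E : seq M) (S : set M) :
  S 0 -> (forall a x y, S x -> S y -> S (a *: x + y)) ->
  {in E, forall x, S x} -> span E `<=` S.
Proof.
move=> S0 SD SE _ [c ->]; elim/big_rec: _ => // i x _ Sx.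
by apply: SD => //; apply/SE/mem_nth.
Qed.

Lemma span_subset (E E' : seq M) : {subset E <= E'} -> span E `<=` span E'.
Proof.
move=> sub; apply: span_sub; [exact: span0|exact: spanP|].
by move=> x xE; apply/span_mem/sub.
Qed.

End Span.

(** In the localization at [p], one of finitely many elements divides all the
others; [s] is a common denominator of the quotients. *)
Lemma least_valuation (R : comPzRingType) (p : set R) (c : nat -> R) (n : nat) :
  prime_ideal p -> (forall a b, comparable_mod (~` p) a b) ->
  exists k s (d : nat -> R), [/\ (k <= n)%N, ~ p s &
    forall i, (i <= n)%N -> s * c i = d i * c k].
Proof.
move=> [_ p1 pM] cmp; have npM s t : ~ p s -> ~ p t -> ~ p (s * t).
  by move=> ns nt /pM[].
elim: n => [|n [k [s [d [kn ns sd]]]]].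
  by exists 0%N, 1, (fun=> 1); split=> // i; rewrite leqn0 => /eqP ->.
have [t nt [[e te]|[e te]]] := cmp (c k) (c n.+1).
- exists k, (s * t), (fun i => if (i <= n)%N then t * d i else s * e).
  split=> [||i]; [exact: leqW|exact: npM|].
  case: ifP => [/sd e' _|/negbT]; first by rewrite mulrAC e' mulrC mulrA.
  by rewrite -ltnNge => ni iS; rewrite (@anti_leq i n.+1) ?iS // -!mulrA te.
- exists n.+1, (s * t), (fun i => if (i <= n)%N then d i * e else s * t).
  split=> [||i]; [exact: leqnn|exact: npM|].
  case: ifP => [/sd e' _|/negbT].
    by rewrite mulrAC e' mulrAC -mulrA te mulrA.
  by rewrite -ltnNge => ni iS; rewrite (@anti_leq i n.+1) ?iS.
Qed.

(** Over a valuation ring a finitely generated torsion-free module is free: in a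
nontrivial linear relation one coefficient divides all the others, and
cancelling it expresses a generator through the remaining ones.  The element
[s] collects the denominators, so the argument stays inside [M]. *)
Lemma torsion_free_local_basis (R : comPzRingType) (p : set R)
    (M : lmodType R) (E : seq M) :
  integral_domain R -> prime_ideal p ->
  (forall a b, comparable_mod (~` p) a b) -> torsion_free M ->
  exists B s, [/\ independent B, ~ p s & {in E, forall x, span B (s *: x)}].
Proof.
move=> [_ dom] prp cmp tfM; have [[p0 _ _] p1 pM] := prp.
have [n En] := ubnP (size E); elim: n => // n IH in E En *.
have [indE|] := pselect (independent E).
  by exists E, 1; split=> // x xE; rewrite scale1r; apply: span_mem.
move=> /existsNP[c /not_implyP[relc /existsNP[j /not_implyP[jE cj]]]].
have [k [s [d [kE ns sd]]]] := least_valuation c (size E).-1 prp cmp.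
have E0 : (0 < size E)%N by apply: leq_ltn_trans jE.
have ltE i : (i <= (size E).-1)%N = (i < size E)%N by rewrite -ltnS prednK.
rewrite ltE in kE.
have ck : c k <> 0.
  move=> ck; have : s * c j = 0 by rewrite sd ?ltE // ck mulr0.
  by case/dom => // s0; apply: ns; rewrite s0.
(* Torsion-freeness allows the coefficient [c k] to be cancelled. *)
have reld : s *: E`_k = - \sum_(i < size E | i != k :> nat) d i *: E`_i.
  apply/eqP; rewrite -addr_eq0; apply/eqP.
  case: (tfM (c k) (s *: E`_k + \sum_(i < size E | i != k :> nat) d i *: E`_i)) => //.
  rewrite -[RHS](scaler0 _ s) -[X in _ = s *: X]relc scaler_sumr.
  rewrite [RHS](bigD1 (Ordinal kE)) //=.
  rewrite scalerDr !scalerA [c k * s]mulrC. congr (_ + _).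
  rewrite scaler_sumr; apply: eq_big => [i|i _]; first by rewrite -val_eqE.
  by rewrite !scalerA sd ?ltE // mulrC.
pose E' := [seq E`_i | i <- rem k (iota 0 (size E))].
have [|B [s' [indB ns' BP]]] := IH E'.
  rewrite size_map size_rem ?mem_iota //= size_iota.
  by rewrite -ltnS prednK.
have BE i : (i < size E)%N -> i != k -> span B (s' *: E`_i).
  move=> iE ik; apply/BP/map_f.
  by rewrite mem_rem_uniq ?iota_uniq // inE ik mem_iota.
exists B, (s' * s); split=> //; first by move=> /pM[].
move=> _ /(nthP 0)[i iE <-]; have [->|ik] := eqVneq i k; last first.
  by rewrite mulrC -scalerA; apply/spanZ/BE.
rewrite -scalerA reld scalerN -scaleN1r; apply: spanZ.
rewrite scaler_sumr; elim/big_rec: _ => [|l x lk Bx]; first exact: span0.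
by apply: spanD => //; rewrite scalerA mulrC -scalerA; apply/spanZ/BE.
Qed.

(** * Flat modules *)

Section PureTensors.
Variables (R : comPzRingType) (N M : lmodType R).

Lemma tensor_add_pi (s t : seq (N * M)) :
  \pi_(tensor N M) s + \pi_(tensor N M) t = \pi_(tensor N M) (s ++ t).
Proof. exact: tensor_addE. Qed.

Lemma pureDr (x : N) (y y' : M) : pure x (y + y') = pure x y + pure x y'.
Proof. by rewrite /pure tensor_add_pi; apply/tensor_piE; exact: TensorDr. Qed.

Lemma pureDl (x x' : N) (y : M) : pure (x + x') y = pure x y + pure x' y.
Proof. by rewrite /pure tensor_add_pi; apply/tensor_piE; exact: TensorDl. Qed.

Lemma pureZ a (x : N) (y : M) : pure (a *: x) y = pure x (a *: y).
Proof. by apply/tensor_piE; exact: TensorZ. Qed.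

Lemma scale_pure a (x : N) (y : M) : a *: pure x y = pure (a *: x) y.
Proof. exact: tensor_scaleE. Qed.

Lemma pure0l (y : M) : pure (0 : N) y = 0.
Proof. by apply/tensor_piE; exact: Tensor0l. Qed.

Lemma pure0r (x : N) : pure x (0 : M) = 0.
Proof. by apply/tensor_piE; exact: Tensor0r. Qed.

Lemma pure_suml (J : Type) (r : seq J) (x : J -> N) (y : M) :
  pure (\sum_(j <- r) x j) y = \sum_(j <- r) pure (x j) y.
Proof.
exact: (big_morph (fun z => pure z y) (fun z z' => pureDl z z' y) (pure0l y)).
Qed.

Lemma pure_sumr (J : Type) (r : seq J) (x : N) (y : J -> M) :
  pure x (\sum_(j <- r) y j) = \sum_(j <- r) pure x (y j).
Proof. exact: (big_morph _ (pureDr x) (pure0r x)). Qed.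

Lemma pi_tensor_sum (s : seq (N * M)) :
  \pi_(tensor N M) s = \sum_(z <- s) pure z.1 z.2.
Proof.
elim: s => [|[x y] s IH]; first by rewrite big_nil.
by rewrite big_cons -IH /pure tensor_add_pi.
Qed.

Definition linear_on (L : lmodType R) (S : set M) (f : M -> L) : Prop :=
  forall a y y', S y -> S y' -> f (a *: y + y') = a *: f y + f y'.

(** A derivation of [tensor_rel s t] mentions finitely many elements of [M]; [E]
lists them.  Hence [beta] has to be linear in its second variable only on their
span, which matters for coordinate functions that do not extend to all of
[M]. *)
Lemma tensor_rel_eval (L : lmodType R) (s t : seq (N * M)) :
  tensor_rel s t -> exists E : seq M, forall beta : N -> M -> L,
    (forall y, linear (beta ^~ y)) ->
    (forall x, linear_on (span E) (beta x)) ->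
    \sum_(z <- s) beta z.1 z.2 = \sum_(z <- t) beta z.1 z.2.
Proof.
have on0 E (f : M -> L) : linear_on (span E) f -> f 0 = 0.
  move=> linf; have := linf 1 _ _ (span0 E) (span0 E).
  by rewrite !scale1r addr0 => /eqP; rewrite -subr_eq0 opprD addNKr oppr_eq0 => /eqP.
have onD E (f : M -> L) y y' : linear_on (span E) f -> y \in E -> y' \in E ->
    f (y + y') = f y + f y'.
  move=> linf /span_mem Ey /span_mem Ey'.
  by rewrite -[y in LHS]scale1r linf // scale1r.
have onZ E (f : M -> L) a y : linear_on (span E) f -> y \in E ->
    f (a *: y) = a *: f y.
  move=> linf /span_mem Ey; rewrite -[X in f X]addr0 linf //; last exact: span0.
  by rewrite (on0 E) ?addr0.
have onS E E' (f : M -> L) : {subset E <= E'} ->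
    linear_on (span E') f -> linear_on (span E) f.
  by move=> /span_subset sub linf a y y' /sub Ey /sub Ey'; apply: linf.
have linL (f : N -> L) : linear f ->
    [/\ f 0 = 0, (forall x y, f (x + y) = f x + f y)
      & (forall a x, f (a *: x) = a *: f x)].
  move=> linf; have f0 : f 0 = 0.
    by have := linf (-1) 0 0; rewrite scaler0 addr0 scaleN1r addNr.
  split=> // [x y|a x]; first by rewrite -[x in LHS]scale1r linf scale1r.
  by rewrite -[X in f X]addr0 linf f0 addr0.
elim=> {s t}.
- by move=> s; exists [::].
- by move=> s t _ [E EP]; exists E => beta bl br; rewrite (EP beta).
- move=> s t u _ [E EP] _ [E' EP']; exists (E ++ E') => beta bl br.
  rewrite (EP beta) ?(EP' beta) // => x; apply: onS (br x) => y yE;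
  by rewrite mem_cat yE ?orbT.
- by move=> s t st; exists [::] => beta _ _; apply: perm_big.
- move=> s s' t t' _ [E EP] _ [E' EP']; exists (E ++ E') => beta bl br.
  rewrite !big_cat /=.
  rewrite (EP beta) ?(EP' beta) // => x; apply: onS (br x) => y yE;
  by rewrite mem_cat yE ?orbT.
- move=> y; exists [::] => beta bl br; rewrite big_seq1 big_nil /=.
  by have [] := linL _ (bl y).
- move=> x x' y; exists [::] => beta bl br; rewrite !big_cons !big_nil !addr0 /=.
  by have [_ ->] := linL _ (bl y).
- move=> x; exists [::] => beta bl br; rewrite big_seq1 big_nil /=.
  exact: on0 (br x).
- move=> x y y'; exists [:: y; y'] => beta bl br; rewrite !big_cons !big_nil !addr0 /=.
  by apply: onD (br x) _ _; rewrite !inE eqxx ?orbT.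
- move=> a x y; exists [:: y] => beta bl br; rewrite !big_seq1 /=.
  rewrite (onZ _ _ _ _ (br x)) ?inE //.
  by have [_ _ ->] := linL _ (bl y).
Qed.

End PureTensors.

Lemma tensor_map_pi (R : comPzRingType) (N' N M : lmodType R)
    (u : {linear N' -> N}) (s : seq (N' * M)) :
  tensor_map u (\pi_(tensor N' M) s)
  = \pi_(tensor N M) [seq (u z.1, z.2) | z <- s].
Proof. by apply/tensor_piE/tensor_rel_map/tensor_reprK. Qed.

(** The scalars [a] with [a *: x = a *: y] form an ideal, which is contained in no
maximal ideal. *)
Lemma eq_locally_at_primes (R : comPzRingType) (V : lmodType R) (x y : V) :
  (forall p : set R, prime_ideal p -> exists2 s, ~ p s & s *: x = s *: y) ->
  x = y.
Proof.
move=> loc; pose J := [set a : R | a *: x = a *: y].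
have [J1|J1] := pselect (J 1); first by rewrite -[x]scale1r J1 scale1r.
have [|m maxm Jm] := @proper_ideal_sub_maximal _ J _ J1.
  split; first by rewrite /J /= !scale0r.
  - by rewrite /J /= => a b ea eb; rewrite !scalerDl ea eb.
  - by rewrite /J /= => c a ea; rewrite -!scalerA ea.
by have [s ns /Jm] := loc _ (maximal_ideal_prime maxm).
Qed.

(** After multiplication by [s], a tensor is determined by its coordinates, with
values in [N'], on a local basis [B].  For two tensors with the same image, the
coordinates agree after applying the injective [u], hence they agree. *)
Theorem torsion_free_flat (R : comPzRingType) (M : lmodType R) :
  integral_domain R ->
  (forall p : set R, prime_ideal p -> forall a b, comparable_mod (~` p) a b) ->
  torsion_free M -> flat_module M.
Proof.
move=> dom cmp tfM N' N u u_inj t1 t2.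
elim/tensorW: t1 => s1; elim/tensorW: t2 => s2.
rewrite !tensor_map_pi => /tensor_piE/(tensor_rel_eval N)[E0 E0P].
apply: eq_locally_at_primes => p prp.
pose E := E0 ++ map snd s1 ++ map snd s2.
have [B [s [indB ns BP]]] := torsion_free_local_basis E dom prp (cmp p prp) tfM.
  (* [phi x] lists the coordinates of [s *: x]; independence of [B] makes them
     linear in [x]. *)
  have [x|phi phiP] := @choice M (nat -> R) (fun x c => span E x ->
    s *: x = \sum_(i < size B) c i *: B`_i).
  have [Ex|] := pselect (span E x); last by exists (fun=> 0).
  suff [c ->] : span B (s *: x) by exists c.
  move: x Ex; apply: span_sub => [|a x y Bx By|//].
    by rewrite scaler0; apply: span0.
  by rewrite scalerDr scalerA mulrC -scalerA; apply: spanP.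
have phi_lin i : (i < size B)%N -> forall a y y', span E y -> span E y' ->
    phi (a *: y + y') i = a * phi y i + phi y' i.
  move=> iB a y y' Ey Ey'; apply/eqP; rewrite -subr_eq0; apply/eqP.
  apply: (indB (fun i => phi (a *: y + y') i - (a * phi y i + phi y' i))) => //.
  under eq_bigr do rewrite scalerBl scalerDl -scalerA.
  rewrite sumrB big_split /= -scaler_sumr -!phiP //; last exact: spanP.
  by rewrite scalerDr scalerA mulrC -scalerA subrr.
pose coord (r : seq (N' * M)) i := \sum_(z <- r) phi z.2 i *: z.1.
have coordE i : (i < size B)%N -> coord s1 i = coord s2 i.
  move=> iB; apply: u_inj; rewrite !linear_sum /=.
  under eq_bigr do rewrite linearZ; under [RHS]eq_bigr do rewrite linearZ.
  have := E0P (fun x y => phi y i *: x); rewrite !big_map /=; apply.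
  - by move=> y a x x'; rewrite scalerDr !scalerA mulrC.
  - have E0E : span E0 `<=` span E.
      by apply: span_subset => y; rewrite mem_cat => ->.
    by move=> x a y y' /E0E Ey /E0E Ey'; rewrite phi_lin // scalerDl scalerA.
have scaleE r : {subset map snd r <= E} ->
    s *: \pi_(tensor N' M) r = \sum_(i < size B) pure (coord r i) B`_i.
  move=> rE; rewrite pi_tensor_sum scaler_sumr.
  under [RHS]eq_bigr do rewrite pure_suml.
  rewrite exchange_big /= !big_seq; apply: eq_bigr => z zr.
  rewrite scale_pure pureZ phiP; last by apply/span_mem/rE/map_f.
  by rewrite pure_sumr; apply: eq_bigr => i _; rewrite pureZ.
exists s => //; rewrite !scaleE.
- by apply: eq_bigr => i _; rewrite coordE.
- by move=> y ys; rewrite !mem_cat ys !orbT.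
- by move=> y ys; rewrite !mem_cat ys !orbT.
Qed.

(** Multiplication by [a <> 0] is injective on [R], hence on the tensor product of
[R] and [M]; evaluation [b, y |-> b *: y] recovers [x] from the tensor of [1]
and [x]. *)
Theorem flat_torsion_free (R : comPzRingType) (M : lmodType R) :
  integral_domain R -> flat_module M -> torsion_free M.
Proof.
move=> [_ dom] flatM a x ax0; have [a0|/eqP a0] := eqVneq a 0; [by left|right].
pose mula : R^o -> R^o := *%R a.
have mula_lin : linear mula.
  by move=> b y z; rewrite /mula mulrDr -[b *: y]/(b * y) -[b *: _]/(b * _) mulrCA.
pose u : {linear R^o -> R^o} :=
  HB.pack mula (GRing.isLinear.Build _ _ _ _ _ mula_lin).
have u_inj : injective u.
  move=> y z /= /eqP; rewrite -subr_eq0 -mulrBr => /eqP/dom[//|/eqP].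
  by rewrite subr_eq0 => /eqP.
have /(flatM _ _ u u_inj) : tensor_map u (pure (1 : R^o) x) = tensor_map u 0.
  rewrite -(pure0r _ (1 : R^o)) !tensor_map_pure /= /mula.
  by rewrite mulr1 -[a]mulr1 -[a * 1]/(a *: (1 : R^o)) !pureZ ax0 scaler0.
move=> /tensor_piE/(tensor_rel_eval M)[E /(_ (fun b y => b *: y))].
rewrite big_seq1 big_nil /= scale1r; apply.
- by move=> y b c d; rewrite scalerDl scalerA.
- by move=> b c y y' _ _; rewrite scalerDr !scalerA mulrC.
Qed.

(** * Submodules as modules *)

Definition submodule (R : pzRingType) (M : lmodType R) (S : set M) : Prop :=
  S 0 /\ forall a x y, S x -> S y -> S (a *: x + y).

(** The closure proof is an argument so that the submodule structure can be
inferred from the predicate. *)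
Definition submodule_pred (R : pzRingType) (M : lmodType R) (S : set M)
  (subS : submodule S) : {pred M} := fun x => `[< S x >].

Lemma submodule_pred_closed (R : pzRingType) (M : lmodType R) (S : set M)
  (subS : submodule S) : GRing.submod_closed (submodule_pred subS).
Proof.
case: (subS) => S0 SD; split; first exact/asboolP.
by move=> a x y /asboolP Sx /asboolP Sy; apply/asboolP/SD.
Qed.

HB.instance Definition _ R M S subS :=
  GRing.isSubmodClosed.Build R M (@submodule_pred R M S subS)
    (submodule_pred_closed subS).

Definition submodule_of (R : pzRingType) (M : lmodType R) (S : set M)
  (subS : submodule S) : Type := {x : M | submodule_pred subS x}.

HB.instance Definition _ R M S subS := SubChoice.on (@submodule_of R M S subS).
HB.instance Definition _ R M S subS :=
  [SubChoice_isSubLmodule of @submodule_of R M S subS by <:].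

(** * Charts of a scheme *)

Lemma chart_in (X : ringed_space) (U : opens X) (psi : Spec (sect U) -> X)
    (p : Spec (sect U)) : affine_chart psi -> U (psi p).
Proof. by move=> [[fun_psi _ _] _ _]; apply: fun_psi. Qed.

Lemma chart_surj (X : ringed_space) (U : opens X) (psi : Spec (sect U) -> X)
    (x : X) : affine_chart psi -> U x -> exists p, psi p = x.
Proof. by move=> [[_ _ surj] _ _] /surj[p _ <-]; exists p. Qed.

Lemma spec_basic_open (A : comPzRingType) (f : A) : open (spec_basic f).
Proof.
exists [set f]; apply/seteqP; split=> p /= npf.
- by move=> sub; apply: npf; apply: sub.
- by move=> pf; apply: npf => _ ->.
Qed.

Lemma chart_basic_open (X : ringed_space) (U : opens X)
    (psi : Spec (sect U) -> X) (f : sect U) :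
  affine_chart psi -> exists D : opens X, psi @` spec_basic f = D :> set X.
Proof.
move=> [_ psiO _]; have Do := (psiO _).1 (spec_basic_open f).
by exists (MkOpens Do).
Qed.

(** The images of the basic opens of the spectrum form a basis of the topology of
[U]. *)
Lemma chart_basis (X : ringed_space) (U V : opens X)
    (psi : Spec (sect U) -> X) (p : Spec (sect U)) :
  affine_chart psi -> V (psi p) ->
  exists (f : sect U) (D : opens X),
    [/\ D `<=` V, D `<=` U, psi @` spec_basic f = D :> set X & ~ p f].
Proof.
move=> chart Vp; have [_ psiO _] := chart.
have : open (psi @^-1` V).
  apply/psiO; suff -> : psi @` (psi @^-1` V) = opensI U V by exact: opens_open.
  apply/seteqP; split=> [_ [q Vq <-]|x [/(chart_surj chart)[q <-]] Vq].
  - by split=> //; apply: chart_in.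
  - by exists q.
move=> [E EV]; have : (psi @^-1` V) p by [].
rewrite EV => /= nEp; have [f /not_implyP[Ef npf]] := (existsNP _).2 nEp.
have [D DE] := chart_basic_open f chart; exists f, D; split=> //; rewrite -DE.
- move=> _ [q nqf <-]; suff : (psi @^-1` V) q by [].
  by rewrite EV /= => sub; apply/nqf/sub.
- by move=> _ [q _ <-]; apply: chart_in.
Qed.

Lemma chart_basic_psi (X : ringed_space) (U D : opens X)
    (psi : Spec (sect U) -> X) (f : sect U) (p : Spec (sect U)) :
  psi @` spec_basic f = D :> set X -> ~ p f -> D (psi p).
Proof. by move=> e npf; rewrite /opens_mem -e; exists p. Qed.

Lemma prime_expr (A : comPzRingType) (p : Spec A) (f : A) n : ~ p f -> ~ p (f ^+ n).
Proof.
move=> npf; have [_ p1 pM] := spec_prime p.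
by elim: n => [//|n IH]; rewrite exprS => /pM[].
Qed.

(** A divisibility between germs holds on a basic neighbourhood of the point, and
the sections there are fractions; clearing the two denominators gives [s]. *)
Lemma stalk_comparable (X : ringed_space) (U : opens X)
    (psi : Spec (sect U) -> X) (p : Spec (sect U)) :
  affine_chart psi ->
  (forall a b : stalk (psi p),
     (exists c, b = germ_mul c a) \/ (exists c, a = germ_mul c b)) ->
  forall a b : sect U, comparable_mod (~` p) a b.
Proof.
move=> chart cmp; have Up := chart_in p chart.
have lift (a b : sect U) (c : stalk (psi p)) : germ Up b = germ_mul c (germ Up a) ->
    exists2 s, ~ p s & exists d, s * b = d * a.
  elim/stalkW: c => V Vp c.
  pose W := opensI V U; have Wp : W (psi p) by split.
  rewrite -(germ_res Vp Wp (opensIl _ _)) -[germ Up a](germ_res _ Wp (opensIr _ _)).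
  rewrite germ_mulE => /germP[W' [W'U [W'W [W'p e]]]].
  have [f [D [DW' DU eD npf]]] := chart_basis chart W'p.
  have [_ _ /(_ f D DU eD)[_ locS loc0]] := chart.
  pose DV := subset_trans DW' (subset_trans W'W (opensIl V U)).
  have [n [d ed]] := locS (res DV c).
  have [|k ek] := loc0 (f ^+ n * b - d * a).
    rewrite rmorphB !rmorphM rmorphXn -ed -mulrA; apply/eqP.
    rewrite subr_eq0; apply/eqP; congr (_ * _).
    rewrite -(res_comp W'U DW') e (res_comp _ _ (subset_trans DW' W'W)).
    by rewrite rmorphM !(res_comp _ _ DV) !(res_comp _ _ DU).
  exists (f ^+ k * f ^+ n).
    have [_ _ pM] := spec_prime p.
    by move=> /pM[]; apply: prime_expr.
  exists (f ^+ k * d); apply/eqP; rewrite -subr_eq0 -!mulrA -mulrBr.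
  exact/eqP.
move=> a b; have [[c /lift]|[c /lift]] := cmp (germ Up a) (germ Up b).
- by move=> [s ns e]; exists s => //; left.
- by move=> [s ns e]; exists s => //; right.
Qed.

(** * Integral schemes *)

Lemma sect_empty (X : ringed_space) (U : opens X) :
  ~ (U !=set0) -> (1 : sect U) = 0.
Proof.
move=> U0; apply: (@sect_sep X U False (fun=> U) (fun=> @subset_refl _ U)).
  by move=> x Ux; case: U0; exists x.
by case.
Qed.

(** Irreducibility, except that the space may be empty. *)
Definition nonempty_opens_meet (X : topologicalType) : Prop :=
  forall U V : opens X, U !=set0 -> V !=set0 -> opensI U V !=set0.

(** On the union of two disjoint nonempty opens, the section equal to [1] on one
and [0] on the other is a zero divisor. *)
Lemma integral_irreducible (X : ringed_space) :
  (forall W : opens X, W !=set0 -> integral_domain (sect W)) -> nonempty_opens_meet X.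
Proof.
move=> dom U V U0 V0; apply: contrapT => UV0.
pose W := MkOpens (openU (opens_open U) (opens_open V)).
have UW : U `<=` W by move=> x; left.
have VW : V `<=` W by move=> x; right.
pose B (b : bool) := if b then U else V.
have BW b : B b `<=` W by case: b.
have cov : W `<=` \bigcup_b B b.
  by move=> x [Ux|Vx]; [exists true|exists false].
have [x0 Ux0] := U0; have [y0 Vy0] := V0.
have W0 : W !=set0 by exists x0; left.
have glue (a : bool -> bool) : exists e : sect W, forall b, res (BW b) e = (a b)%:R.
  apply: (@sect_glue X W _ B BW cov (fun b => (a b)%:R)) => b c.
  rewrite !rmorph_nat; have [->//|bc] := eqVneq b c.
  have BB0 : ~ (opensI (B b) (B c) !=set0).
    by move=> [x [Bx Cx]]; apply: UV0; exists x; case: (b) (c) Bx Cx bc => [] [].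
  by case: (a b); case: (a c) => //=; rewrite (sect_empty BB0).
have [e eP] := glue id; have [e' eP'] := glue negb.
have [_ /(_ e e')] := dom W W0; case.
- apply: (@sect_sep X W _ B BW cov) => b; rewrite rmorphM eP eP' rmorph0.
  by case: b; rewrite ?mulr0 ?mul0r.
- move=> e0; have := eP true; rewrite e0 rmorph0 /= => /esym.
  by have [] := dom U U0.
- move=> e0; have := eP' false; rewrite e0 rmorph0 /= => /esym.
  by have [] := dom V V0.
Qed.

(** Near each point [s] is, up to a unit, the restriction of a section [z] over
an affine open.  As [z] vanishes on a nonempty basic open, it is killed by a
power of a nonzero function, so that [z = 0] by torsion-freeness. *)
Lemma flat_section_eq0 (X : scheme) (F : qcoh X) (U V : opens X)
    (VU : V `<=` U) (s : F U) :
  integral_scheme X -> flat_qcoh F -> V !=set0 -> mres F VU s = 0 -> s = 0.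
Proof.
move=> [_ dom] flatF V0 sV.
have near x : U x -> exists D : opens X, exists DU : D `<=` U, D x /\ mres F DU s = 0.
  move=> Ux; have [W [[psi chart] Wx]] := scheme_affine x.
  have Waff : affine_open W by exists psi.
  have [p ep] := chart_surj chart Wx; rewrite -ep in Ux.
  have [f [D [DU DW eD npf]]] := chart_basis chart Ux.
  have Dp := chart_basic_psi eD npf.
  exists D, DU; rewrite -ep; split=> //.
  have [locS _] := @qcoh_prop X F _ _ chart _ _ DW eD.
  have [n [z ez]] := locS (mres F DU s).
  suff z0 : z = 0.
    have [_ _ /(_ f D DW eD)[[v fv] _ _]] := chart.
    have := congr1 (fun w => v ^+ n *: w) ez.
    by rewrite z0 raddf0 scaler0 scalerA -exprMn mulrC fv expr1n scale1r.
  have [y [Vy Dy]] : opensI V D !=set0.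
    by apply: integral_irreducible => //; exists (psi p).
  have [q eq] := chart_surj chart (DW _ Dy).
  have VDq : opensI V D (psi q) by rewrite eq.
  have [g [D' [D'VD D'W eD' nqg]]] := chart_basis chart VDq.
  have D'V := subset_trans D'VD (opensIl V D).
  have D'D := subset_trans D'VD (opensIr V D).
  have [_ loc0] := @qcoh_prop X F _ _ chart _ _ D'W eD'.
  have [|k gz] := loc0 z.
    rewrite -(mres_comp DW D'D) -ez mresZ (mres_comp _ _ (subset_trans D'V VU)).
    by rewrite -(mres_comp VU D'V) sV raddf0 scaler0.
  have W0 : W !=set0 by exists x.
  have := flat_torsion_free (dom W W0) (flatF W Waff) gz; case=> // gk0.
  have [[p0 _ _] _ _] := spec_prime q.
  by case: (prime_expr (n := k) nqg); rewrite gk0.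
pose J := {D : opens X | exists DU : D `<=` U, mres F DU s = 0}.
have JU (j : J) : sval j `<=` U by have [] := svalP j.
apply: (@msect_sep X F U J sval JU) => [x /near[D [DU [Dx sD]]]|j].
- by exists (exist _ D (ex_intro _ DU sD)).
- rewrite raddf0; have [DU <-] := svalP j.
  by congr (mres _ _ _); apply: Prop_irrelevance.
Qed.

(** * The subsheaf of torsion sections *)

Section TorsionSubsheaf.
Variables (X : scheme) (P : sheaf_mod X).
Hypothesis irr : nonempty_opens_meet X.

(** On an integral scheme and for a quasi-coherent [P] this is the usual torsion: a
section killed by [a <> 0] vanishes where [a] is invertible, and a section over
an affine open that vanishes on the basic open of [g] is killed by a power of
[g].  Over the empty set every section has to be admitted, since it is zero. *)
Definition torsion_section (U : opens X) : set (P U) :=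
  [set s | U !=set0 -> exists (V : opens X) (VU : V `<=` U),
    V !=set0 /\ mres P VU s = 0].

Lemma torsion_section_submodule (U : opens X) : submodule (@torsion_section U).
Proof.
split; first by move=> U0; exists U, (@subset_refl _ U); rewrite raddf0.
move=> a x y + + U0 => /(_ U0)[V [VU [V0 xV]]] /(_ U0)[W [WU [W0 yW]]].
pose VW := opensI V W; pose VWU := subset_trans (opensIl V W) VU.
exists VW, VWU; split; first exact: irr.
rewrite raddfD /= mresZ -(mres_comp VU (opensIl V W)) xV raddf0 scaler0 add0r.
by rewrite -(mres_comp WU (opensIr V W)) yW raddf0.
Qed.

Definition torsion_sect (U : opens X) := submodule_of (torsion_section_submodule U).

Lemma torsion_sectP (U : opens X) (s : torsion_sect U) : torsion_section (\val s).
Proof. exact/asboolP/(valP s). Qed.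

Definition torsion_section_in (U : opens X) (s : P U) (ts : torsion_section s) :
  torsion_sect U := Sub s (asboolT ts).

Lemma torsion_section_res (U V : opens X) (VU : V `<=` U) (s : P U) :
  torsion_section s -> torsion_section (mres P VU s).
Proof.
move=> ts V0; have [x Vx] := V0.
have [|W [WU [W0 sW]]] := ts; first by exists x; apply: VU.
exists (opensI V W), (opensIl V W); split; first exact: irr.
rewrite (mres_comp _ _ (subset_trans (opensIr V W) WU)).
by rewrite -(mres_comp WU (opensIr V W)) sW raddf0.
Qed.

Definition torsion_res (U V : opens X) (VU : V `<=` U) (s : torsion_sect U) :
  torsion_sect V :=
  torsion_section_in (torsion_section_res VU (torsion_sectP s)).

Lemma torsion_res_additive (U V : opens X) (VU : V `<=` U) :
  zmod_morphism (torsion_res VU).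
Proof. by move=> s t; apply: val_inj; rewrite /= !raddfB. Qed.

HB.instance Definition _ U V VU := GRing.isZmodMorphism.Build _ _
  (@torsion_res U V VU) (@torsion_res_additive U V VU).

Program Definition torsion_sheaf : sheaf_mod X :=
  @MkSheafMod X (fun U => torsion_sect U) (fun U V VU => @torsion_res U V VU)
    _ _ _ _ _.
Next Obligation. by move=> U V VU a s; apply: val_inj; rewrite /= mresZ. Qed.
Next Obligation. by move=> U UU s; apply: val_inj; rewrite /= mres_id. Qed.
Next Obligation.
by move=> U V W VU WV WU s; apply: val_inj; rewrite /= (mres_comp _ _ WU).
Qed.
Next Obligation.
move=> U I V VU cov s t st; apply: val_inj; apply: (@msect_sep X P U I V VU cov) => i.
by have /(congr1 val) := st i.
Qed.
Next Obligation.
move=> U I V VU cov s compat.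
have [|t tP] := @msect_glue X P U I V VU cov (fun i => \val (s i)).
  by move=> i j; have /(congr1 val) := compat i j.
have tt : torsion_section t.
  move=> [x Ux]; have [i _ Vx] := cov _ Ux.
  have [|W [WV [W0 sW]]] := torsion_sectP (s i); first by exists x.
  exists W, (subset_trans WV (VU i)); split=> //.
  by rewrite -(mres_comp (VU i) WV) tP.
by exists (torsion_section_in tt) => i; apply: val_inj; rewrite /= tP.
Qed.

(** A section [x] extending [f ^+ n *: y] vanishes on the same nonempty open as
[y], hence is torsion as well.  The basic open [V] may be empty; then [y = 0]. *)
Lemma torsion_sheaf_quasi_coherent :
  quasi_coherent P -> quasi_coherent torsion_sheaf.
Proof.
move=> qcP U psi chart f V VU eV; have [locS loc0] := qcP U psi chart f V VU eV.
split=> [y|x /(congr1 val)/= /loc0[n e]]; last first.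
  by exists n; apply: val_inj.
have [V0|V0] := pselect (V !=set0); last first.
  exists 0%N, 0; rewrite -[LHS]scale1r (sect_empty V0) scale0r.
  by rewrite raddf0.
have [n [x ex]] := locS (\val y).
have [W [WV [W0 yW]]] := torsion_sectP y V0.
have tx : torsion_section x.
  move=> _; exists W, (subset_trans WV VU); split=> //.
  by rewrite -(mres_comp VU WV) -ex mresZ yW scaler0.
by exists n, (torsion_section_in tx); apply: val_inj.
Qed.

End TorsionSubsheaf.

Definition torsion_qcoh (X : scheme) (P : qcoh X)
    (irr : nonempty_opens_meet X) : qcoh X :=
  MkQcoh (torsion_sheaf_quasi_coherent irr (@qcoh_prop X P)).

Definition torsion_incl (X : scheme) (P : qcoh X) (irr : nonempty_opens_meet X) :
  qcoh_hom (torsion_qcoh P irr) P :=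
  @MkQcohHom X (torsion_qcoh P irr) P (fun U => \val) (fun U V VU s => erefl).

(** * Products of flat sheaves *)

Definition zero_hom (X : scheme) (F G : qcoh X) : qcoh_hom F G :=
  @MkQcohHom X F G (fun U => \0) (fun U V VU s => esym (raddf0 (mres G VU))).

Definition comp_hom (X : scheme) (F G H : qcoh X) (g : qcoh_hom G H)
    (f : qcoh_hom F G) : qcoh_hom F H :=
  @MkQcohHom X F H (fun U => g U \o f U)
    (fun U V VU s => etrans (congr1 (g V) (hom_res f VU s))
                            (hom_res g VU (f U s))).

(** The inclusion of the torsion subsheaf and the zero morphism have the same
composites with every projection, because the flat sheaves [F i] contain no
nonzero torsion section. *)
Lemma product_torsion_section_eq0 (X : scheme) (I : Type) (F : I -> qcoh X)
    (P : qcoh X) (pr : forall i : I, qcoh_hom P (F i)) :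
  integral_scheme X -> is_qcoh_product pr -> (forall i, flat_qcoh (F i)) ->
  forall (U : opens X) (s : P U), torsion_section s -> s = 0.
Proof.
move=> intX prodP flatF U s ts.
pose irr := integral_irreducible (proj2 intX).
pose T := torsion_qcoh P irr; pose incl := torsion_incl P irr.
have pr_incl0 i V (t : T V) : pr i V (incl V t) = 0.
  have [V0|V0] := pselect (V !=set0); last first.
    by rewrite -[LHS]scale1r (sect_empty V0) scale0r.
  have [W [WV [W0 tW]]] := torsion_sectP t V0.
  apply: (flat_section_eq0 (VU := WV) intX (flatF i) W0).
  by rewrite -hom_res [mres _ _ _]tW raddf0.
have [_ uniq] := prodP T (fun i => comp_hom (pr i) incl).
have := uniq incl (zero_hom T P) (fun _ _ _ => erefl).
move=> /(_ _ U (torsion_section_in irr ts)); apply => i V t.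
by rewrite /= pr_incl0 raddf0.
Qed.

(** A section killed by [a] vanishes on the basic open of [a].  For [a <> 0] this
open is nonempty because the zero ideal of a domain is a prime that does not
contain [a]. *)
Lemma integral_torsion_section (X : scheme) (P : qcoh X) (U : opens X)
    (a : sect U) (s : P U) :
  integral_scheme X -> affine_open U -> a *: s = 0 -> a = 0 \/ torsion_section s.
Proof.
move=> [_ dom] [psi chart] as0; have [->|/eqP a0] := eqVneq a 0; [by left|right].
move=> U0; have [one0 domU] := dom U U0.
have pr0 : prime_ideal [set 0 : sect U].
  split=> //; split=> //= [_ _ -> ->|c _ ->]; [exact: addr0|exact: mulr0].
have [D eD] := chart_basic_open a chart.
have DU : D `<=` U by rewrite -eD => _ [p _ <-]; apply: chart_in.
exists D, DU; split.
  by exists (psi (MkSpec pr0)); rewrite -eD; exists (MkSpec pr0).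
have [_ _ /(_ a D DU eD)[[v av] _ _]] := chart.
by rewrite -[LHS]scale1r -av mulrC -scalerA -mresZ as0 raddf0 scaler0.
Qed.

Lemma zero_ring_flat (R : comPzRingType) (M : lmodType R) :
  (1 : R) = 0 -> flat_module M.
Proof.
by move=> R0 N' N u _ t t' _; rewrite -[t]scale1r -[t']scale1r R0 !scale0r.
Qed.

Theorem corollary3p9 (X : scheme) (I : Type) (F : I -> qcoh X) (P : qcoh X)
    (pr : forall i : I, qcoh_hom P (F i)) :
  dedekind_scheme X ->
  is_qcoh_product pr ->
  (forall i : I, flat_qcoh (F i)) ->
  flat_qcoh P.
Proof.
move=> [intX _ reg] prodP flatF U affU.
have [U0|/sect_empty/zero_ring_flat //] := pselect (U !=set0).
apply: torsion_free_flat; first by case: intX => _; apply.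
- move=> p prp; have [psi chart] := affU.
  have [d d1 regp] := reg (psi (MkSpec prp)).
  have cmp := regular_local_comparable d1 regp.
  exact: (stalk_comparable (p := MkSpec prp) chart cmp).
- move=> a s /(integral_torsion_section intX affU)[->|ts]; [by left|right].
  exact: product_torsion_section_eq0 ts.
Qed.
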